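(* In the multi-attribute setting with smoothing parameter $\eta=1$, the greedy algorithm MultiNashANN described in the context runs in polynomial time and, given any query $q\in\mathbb{R}^d$, returns a size-$k$ subset $\textsc{Alg}\subseteq P$ with $$\log\mathrm{NSW}(\textsc{Alg})\ \ge\ \Big(1-\frac1e\Big)\log\mathrm{NSW}(\textsc{Opt}),$$ where $\textsc{Opt}\in\arg\max_{S\subseteq P,|S|=k}\log\mathrm{NSW}(S)$.
   Context: Setting: $P\subset\mathbb{R}^d$ is a finite set of input vectors, $\sigma:\mathbb{R}^d\times\mathbb{R}^d\to\mathbb{R}_{\ge0}$ a similarity function, $k$ a positive integer with $k\le|P|$, and $[c]=\{1,\dots,c\}$ attributes. Each $v\in P$ has a nonempty attribute set $\mathrm{atb}(v)\subseteq[c]$ (sets may overlap across attributes), and $D_\ell=\{v\in P:\ell\in\mathrm{atb}(v)\}$. For a query $q$ and $S\subseteq P$, $u_\ell(S)=\sum_{v\in S\cap D_\ell}\sigma(q,v)$ and $\log\mathrm{NSW}(S)=\frac1c\sum_{\ell=1}^c\log(u_\ell(S)+\eta)$. Algorithm MultiNashANN: start with $\textsc{Alg}=\emptyset$; for $i=1,\dots,k$, pick $\widehat v\in\arg\max_{v\in P\setminus\textsc{Alg}}\big(\log\mathrm{NSW}(\textsc{Alg}\cup\{v\})-\log\mathrm{NSW}(\textsc{Alg})\big)$ and set $\textsc{Alg}\leftarrow\textsc{Alg}\cup\{\widehat v\}$; return $\textsc{Alg}$. *)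

(* Defs.v *)
From HB Require Import structures.
From mathcomp Require Import all_boot all_order all_algebra finmap.
From mathcomp Require Import all_classical all_reals all_analysis.

Set Implicit Arguments.
Unset Strict Implicit.
Unset Printing Implicit Defensive.

Import Order.TTheory GRing.Theory Num.Theory.

Local Open Scope classical_set_scope.
Local Open Scope ring_scope.

Definition argmax {R : realType} {T : Type} (D : set T) (f : T -> R) : set T :=
  [set x | D x /\ forall y, D y -> f y <= f x].

Section MultiAttribute.
Variables (R : realType) (d c : nat).
Local Notation vec := 'rV[R]_d.

Variables (P : {fset vec}) (sigma : vec -> vec -> R) (atb : vec -> {set 'I_c}).

Definition attr_class (l : 'I_c) : {fset vec} :=
  [fset v in P | l \in atb v]%fset.

Definition utility (q : vec) (l : 'I_c) (S : {fset vec}) : R :=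
  \sum_(v <- (S `&` attr_class l)%fset) sigma q v.

Definition logNSW (eta : R) (q : vec) (S : {fset vec}) : R :=
  c%:R^-1 * \sum_(l < c) ln (utility q l S + eta).

Definition optimal (eta : R) (k : nat) (q : vec) : set {fset vec} :=
  argmax [set S : {fset vec} | (S `<=` P)%fset /\ #|` S|%fset = k]
         (logNSW eta q).

(* [greedy eta q i A]: A is a possible value of the current set after i rounds.
   Being a relation, it covers every way of breaking ties in the arg max. *)
Inductive greedy (eta : R) (q : vec) : nat -> {fset vec} -> Prop :=
| greedy_start : greedy eta q 0 fset0
| greedy_round i A v :
    greedy eta q i A ->
    argmax [set w | w \in (P `\` A)%fset]
      (fun w => logNSW eta q (A `|` [fset w])%fset - logNSW eta q A) v ->
    greedy eta q i.+1 (A `|` [fset v])%fset.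

End MultiAttribute.

(* A real RAM with bounded loops.  The memory consists of arrays of naturals
   and arrays of reals, both initially zero.  Programs are closed syntax, fixed
   independently of the instance; they access the similarity and the attributes
   only through [RSim] and [BAtb].  Every syntactic node costs one step each
   time it is executed, except that evaluating the similarity costs [tau].
   Real arithmetic, ln and comparison of reals are exact, at unit cost. *)

Inductive nexp :=
| NLit of nat                 (* a literal *)
| NGet of nat & nexp.         (* [NGet a i]: cell i of the natural array a *)

Inductive rexp :=
| RNat of nexp                (* the natural number as a real *)
| RGet of nat & nexp          (* [RGet a i]: cell i of the real array a *)
| RAdd of rexp & rexp
| RSub of rexp & rexp
| RDiv of rexp & rexp
| RLn of rexp
| RSim of nexp.               (* sigma (query, i-th input vector) *)

Inductive bexp :=
| BEq of nexp & nexp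
| BLt of rexp & rexp
| BOr of bexp & bexp
| BAtb of nexp & nexp.        (* does input vector i have attribute l? *)

Inductive cmd :=
| Skip
| Seq of cmd & cmd
| NSet of nat & nexp & nexp   (* [NSet a i e]: cell i of array a := e *)
| RSet of nat & nexp & rexp
| If of bexp & cmd & cmd
| For of nat & nexp & cmd.    (* [For x e p]: p with x[0] = 0, ..., e - 1 *)

Record memory (R : realType) := Memory {
  nmem : nat -> nat -> nat;
  rmem : nat -> nat -> R
}.

Definition upd {T : Type} (m : nat -> nat -> T) (a i : nat) (x : T) :
    nat -> nat -> T :=
  fun a' i' => if (a' == a) && (i' == i) then x else m a' i'.

Section Semantics.
Local Open Scope nat_scope.
Variables (R : realType) (d c : nat).
Local Notation vec := 'rV[R]_d.

(* [ps] lists the input vectors. *)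
Variables (sigma : vec -> vec -> R) (atb : vec -> {set 'I_c}).
Variables (ps : seq vec) (q : vec) (tau : nat).

Fixpoint neval (m : memory R) (e : nexp) : nat :=
  match e with
  | NLit n => n
  | NGet a i => nmem m a (neval m i)
  end.

Fixpoint reval (m : memory R) (e : rexp) : R :=
  match e with
  | RNat n => (neval m n)%:R%R
  | RGet a i => rmem m a (neval m i)
  | RAdd x y => (reval m x + reval m y)%R
  | RSub x y => (reval m x - reval m y)%R
  | RDiv x y => (reval m x / reval m y)%R
  | RLn x => ln (reval m x)
  | RSim i => sigma q (nth 0%R ps (neval m i))
  end.

Fixpoint beval (m : memory R) (b : bexp) : bool :=
  match b with
  | BEq x y => neval m x == neval m y
  | BLt x y => (reval m x < reval m y)%R
  | BOr b1 b2 => beval m b1 || beval m b2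
  | BAtb i l =>
      neval m l \in [seq val j | j in atb (nth 0%R ps (neval m i))]
  end.

Fixpoint ncost (e : nexp) : nat :=
  match e with
  | NLit _ => 1
  | NGet _ i => (ncost i).+1
  end.

Fixpoint rcost (e : rexp) : nat :=
  match e with
  | RNat i | RGet _ i => (ncost i).+1
  | RAdd x y | RSub x y | RDiv x y => (rcost x + rcost y).+1
  | RLn x => (rcost x).+1
  | RSim i => (ncost i + tau).+1
  end.

Fixpoint bcost (b : bexp) : nat :=
  match b with
  | BEq x y | BAtb x y => (ncost x + ncost y).+1
  | BLt x y => (rcost x + rcost y).+1
  | BOr b1 b2 => (bcost b1 + bcost b2).+1
  end.

(* The final memory and the number of steps.  The bound of a loop is evaluated
   once, on entry, and each iteration costs one step besides its body. *)
Fixpoint run (p : cmd) (m : memory R) : memory R * nat :=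
  match p with
  | Skip => (m, 1)
  | Seq p1 p2 =>
      let r1 := run p1 m in
      let r2 := run p2 r1.1 in
      (r2.1, (r1.2 + r2.2).+1)
  | NSet a i e =>
      (Memory (upd (nmem m) a (neval m i) (neval m e)) (rmem m),
       (ncost i + ncost e).+1)
  | RSet a i e =>
      (Memory (nmem m) (upd (rmem m) a (neval m i) (reval m e)),
       (ncost i + rcost e).+1)
  | If b p1 p2 =>
      let r := if beval m b then run p1 m else run p2 m in
      (r.1, (bcost b + r.2).+1)
  | For x e p1 =>
      foldl (fun s j =>
               let r := run p1 (Memory (upd (nmem s.1) x 0 j) (rmem s.1)) in
               (r.1, (s.2 + r.2).+1))
            (m, (ncost e).+1) (iota 0 (neval m e))
  end.

End Semantics.

(* Scalars are cell 0 of their array. *)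
Declare Scope ram_scope.
Local Notation "x ;; y" := (Seq x y) (at level 70, right associativity) : ram_scope.
Local Notation nvar x := (NGet x (NLit 0)).
Local Notation rvar x := (RGet x (NLit 0)).
Local Open Scope ram_scope.

(* natural arrays *)
Definition vN : nat := 0.      (* input: |P| *)
Definition vC : nat := 1.      (* input: c *)
Definition vK : nat := 2.      (* input: k *)
Definition vRound : nat := 3.
Definition vI : nat := 4.
Definition vL : nat := 5.
Definition vFound : nat := 6.
Definition vBest : nat := 7.
Definition vSel : nat := 8.    (* output: vSel[i] = 1 iff the i-th vector is chosen *)
(* real arrays *)
Definition wU : nat := 0.      (* wU[l] = utility of the current set for l *)
Definition wNew : nat := 1.
Definition wGain : nat := 2.
Definition wBest : nat := 3.

(* wGain := marginal gain (with eta = 1) of the vector of index vI *)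
Definition compute_gain : cmd :=
  RSet wGain (NLit 0) (RNat (NLit 0)) ;;
  For vL (nvar vC)
    (RSet wNew (NLit 0) (RGet wU (nvar vL)) ;;
     If (BAtb (nvar vI) (nvar vL))
        (RSet wNew (NLit 0) (RAdd (rvar wNew) (RSim (nvar vI))))
        Skip ;;
     RSet wGain (NLit 0)
       (RAdd (rvar wGain)
          (RSub (RLn (RAdd (rvar wNew) (RNat (NLit 1))))
                (RLn (RAdd (RGet wU (nvar vL)) (RNat (NLit 1))))))) ;;
  RSet wGain (NLit 0) (RDiv (rvar wGain) (RNat (nvar vC))).

Definition find_best : cmd :=
  NSet vFound (NLit 0) (NLit 0) ;;
  For vI (nvar vN)
    (If (BEq (NGet vSel (nvar vI)) (NLit 0))
        (compute_gain ;;
         If (BOr (BEq (nvar vFound) (NLit 0))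
                 (BLt (rvar wBest) (rvar wGain)))
            (NSet vFound (NLit 0) (NLit 1) ;;
             NSet vBest (NLit 0) (nvar vI) ;;
             RSet wBest (NLit 0) (rvar wGain))
            Skip)
        Skip).

Definition add_best : cmd :=
  NSet vSel (nvar vBest) (NLit 1) ;;
  For vL (nvar vC)
    (If (BAtb (nvar vBest) (nvar vL))
        (RSet wU (nvar vL) (RAdd (RGet wU (nvar vL)) (RSim (nvar vBest))))
        Skip).

Definition multiNashANN : cmd :=
  For vRound (nvar vK) (find_best ;; add_best).

Definition init_memory (R : realType) (n c k : nat) : memory R :=
  Memory
    (upd (upd (upd (fun _ _ => 0%N) vN 0 n) vC 0 c) vK 0 k)
    (fun _ _ => 0).

Section Result.
Variables (R : realType) (d c : nat).
Local Notation vec := 'rV[R]_d.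
Variables (sigma : vec -> vec -> R) (atb : vec -> {set 'I_c}).
Variables (ps : seq vec) (k : nat) (q : vec) (tau : nat).

Definition multiNashANN_run : memory R * nat :=
  run sigma atb ps q tau multiNashANN (init_memory R (size ps) c k).

Definition multiNashANN_output : {fset vec} :=
  [fset v in ([seq nth 0%R ps i | i <- iota 0 (size ps)
                 & nmem multiNashANN_run.1 vSel i == 1%N] : seq vec)]%fset.

Definition multiNashANN_time : nat := multiNashANN_run.2.

End Result.

(* Main.v *)
(** The objective f = log NSW with eta = 1 satisfies f(empty) = 0, is monotone,
    and is submodular because ln (a + x + y) - ln a is at most the sum of
    ln (a + x) - ln a and ln (a + y) - ln a.  Hence the gap f(Opt) - f(A) is at
    most k times the best marginal gain at A, each greedy round multiplies the
    gap by at most 1 - 1/k, and (1 - 1/k)^k <= 1/e.  For the program, the loop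
    invariants say that the array of utilities is that of the selected set, that
    this set is a greedy prefix, and that the candidate kept by the inner loop
    has the largest gain among the free indices scanned so far; three nested
    loops bounded by k, |P| and c, with tau charged innermost, give a polynomial
    of degree 4. *)
Require Import Defs.
From HB Require Import structures.
From mathcomp Require Import all_boot all_order all_algebra finmap.
From mathcomp Require Import all_classical all_reals all_analysis.
From mathcomp Require Import zify ring lra.
Import Order.TTheory GRing.Theory Num.Theory.
Local Open Scope classical_set_scope.
Local Open Scope ring_scope.

(** * Inequalities for ln and exp *)

(** Each induction step reduces to a (a + x + t) <= (a + x) (a + t), whose sides differ by x t >=
    0. *)
Lemma ln_sub_sum_le {R : realType} {I : Type} (s : seq I) (x : I -> R) (a : R) :
  0 < a -> (forall i, 0 <= x i) ->
  ln (a + \sum_(i <- s) x i) - ln a <= \sum_(i <- s) (ln (a + x i) - ln a).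
Proof.
move=> a0 x0; elim: s => [|i s IHs]; first by rewrite !big_nil addr0 subrr.
rewrite !big_cons; set t := \sum_(j <- s) x j in IHs *.
have t0 : 0 <= t by exact: sumr_ge0.
have xi0 := x0 i.
apply: le_trans (lerD (lexx _) IHs).
rewrite -subr_ge0.
suff : ln (a * (a + (x i + t))) <= ln ((a + x i) * (a + t)).
  by rewrite !lnM ?posrE; lra.
rewrite ler_ln ?posrE; last 2 first.
- by apply: mulr_gt0; lra.
- by apply: mulr_gt0; lra.
by have := mulr_ge0 xi0 t0; lra.
Qed.

(** 1/e is the k-th power of exp (-1/k), and 1 + y <= exp y at y = -1/k. Passing to powers uses 1 -
    1/k >= 0, hence k >= 1. *)
Lemma expr_1sub_inv_le {R : realType} (k : nat) :
  (0 < k)%N -> (1 - k%:R^-1) ^+ k <= (expR 1)^-1 :> R.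
Proof.
move=> k0.
have kge1 : 1 <= k%:R :> R by rewrite ler1n.
have kp : 0 < k%:R :> R by rewrite ltr0n.
have -> : (expR 1)^-1 = expR (- k%:R^-1) ^+ k :> R.
  by rewrite -expRM_natr mulNr mulVf ?gt_eqF// expRN.
apply: lerXn2r; rewrite ?nnegrE ?expR_ge0//.
- by rewrite subr_ge0 invf_le1.
- exact: expR_ge1Dx.
Qed.

(** * Submodularity of log NSW and the greedy guarantee *)

Section Objective.
Variables (R : realType) (d c : nat) (P : {fset 'rV[R]_d}).
Variables (sigma : 'rV[R]_d -> 'rV[R]_d -> R) (atb : 'rV[R]_d -> {set 'I_c}).
Hypothesis sigma_ge0 : forall x y, 0 <= sigma x y.
Variable q : 'rV[R]_d.

Local Notation u := (utility P sigma atb q).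
Local Notation f := (logNSW P sigma atb 1 q).
Local Notation D := (attr_class P atb).

(** Extension by zero outside the attribute class makes the utility an additive function of the
    set. *)
Definition attr_weight l v : R := if v \in D l then sigma q v else 0.

Lemma attr_weight_ge0 l v : 0 <= attr_weight l v.
Proof. by rewrite /attr_weight; case: ifP. Qed.

Lemma utilityE l A : u l A = \sum_(v <- A) attr_weight l v.
Proof.
rewrite /utility -big_mkcond/= [RHS]big_fset_condE.
by congr (\sum_(i <- enum_fset _) _); apply/fsetP => v; rewrite !inE.
Qed.

Lemma utility_ge0 l A : 0 <= u l A.
Proof. by rewrite utilityE sumr_ge0// => v _; exact: attr_weight_ge0. Qed.

Lemma utilityU l A B : u l (A `|` B)%fset = u l A + u l (B `\` A)%fset.
Proof.
rewrite !utilityE (big_fsetID _ (mem A))/=.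
congr (_ + _); congr (\sum_(i <- enum_fset _) _); apply/fsetP => v;
  by rewrite !inE; case: (v \in A); rewrite ?orbT ?andbF ?andbT.
Qed.

Lemma utilityU1 l A v : v \notin A ->
  u l (A `|` [fset v])%fset = u l A + attr_weight l v.
Proof.
move=> vA; rewrite utilityU; congr (_ + _).
rewrite utilityE.
transitivity (\sum_(w <- [fset v]%fset) attr_weight l w).
  congr (\sum_(i <- enum_fset _) _); apply/fsetP => w.
  by rewrite !inE andb_idl// => /eqP->.
by rewrite big_seq_fset1.
Qed.

(** Here eta = 1 enters: as ln 1 = 0, the gap before the first round is exactly f(Opt), which makes
    the guarantee purely multiplicative. *)
Lemma logNSW0 : f fset0 = 0.
Proof.
by rewrite /logNSW big1 ?mulr0// => l _; rewrite utilityE big_nil add0r ln1.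
Qed.

Lemma logNSW_ge0 A : 0 <= f A.
Proof.
rewrite mulr_ge0 ?invr_ge0// sumr_ge0// => l _.
by rewrite ln_ge0// lerDr utility_ge0.
Qed.

Lemma logNSWU_ge A B : f A <= f (A `|` B)%fset.
Proof.
rewrite ler_wpM2l ?invr_ge0//; apply: ler_sum => l _.
have ? := utility_ge0 l A; have ? := utility_ge0 l (B `\` A)%fset.
by rewrite utilityU ler_ln ?posrE; lra.
Qed.

(** For each attribute [l], [ln_sub_sum_le] applies with base [u l A + 1]; exchanging the sums over
    attributes and vectors gives the gains. *)
Lemma logNSWU_sub_le A B :
  f (A `|` B)%fset - f A <=
    \sum_(v <- (B `\` A)%fset) (f (A `|` [fset v])%fset - f A).
Proof.
have -> : \sum_(v <- (B `\` A)%fset) (f (A `|` [fset v])%fset - f A) =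
    c%:R^-1 * \sum_(l < c) \sum_(v <- (B `\` A)%fset)
      (ln (u l A + 1 + attr_weight l v) - ln (u l A + 1)).
  rewrite exchange_big mulr_sumr; apply: eq_big_seq => v.
  rewrite !inE => /andP[vA _].
  rewrite /logNSW -mulrBr -sumrB; congr (_ * _); apply: eq_bigr => l _.
  by rewrite utilityU1// addrAC.
rewrite /logNSW -mulrBr -sumrB ler_wpM2l ?invr_ge0//; apply: ler_sum => l _.
rewrite utilityU [in u l (_ `\` _)%fset]utilityE addrAC.
by apply: ln_sub_sum_le => [|v]; [have := utility_ge0 l A; lra|exact: attr_weight_ge0].
Qed.

Lemma greedy_sub_card i A :
  greedy P sigma atb 1 q i A -> (A `<=` P)%fset /\ #|` A|%fset = i.
Proof.
elim=> {i A} [|i A v _ [AP cA] [/= vPA _]]; first by rewrite fsub0set cardfs0.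
move: vPA; rewrite !inE => /andP[vA vP]; split.
  by rewrite fsubUset AP fsub1set.
by rewrite fsetUC cardfsU1 vA cA.
Qed.

Lemma greedy_gap k Opt i A :
  (0 < k)%N -> (Opt `<=` P)%fset -> #|` Opt|%fset = k ->
  greedy P sigma atb 1 q i A ->
  f Opt - f A <= (1 - k%:R^-1) ^+ i * f Opt.
Proof.
move=> k0 OP cO.
have kge1 : 1 <= k%:R :> R by rewrite ler1n.
have kp : 0 < k%:R :> R by rewrite ltr0n.
elim=> {i A} [|i A v _ IH [/= vPA vmax]].
  by rewrite logNSW0 expr0 mul1r subr0.
set g := f (A `|` [fset v])%fset - f A.
have g0 : 0 <= g by rewrite subr_ge0 logNSWU_ge.
(* Monotonicity enlarges Opt to its union with A, submodularity splits the difference into single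
   gains, and the greedy choice bounds each of them by [g]. *)
have step : f Opt - f A <= k%:R * g.
  apply: (@le_trans _ _ (f (A `|` Opt)%fset - f A)).
    by rewrite lerB// fsetUC logNSWU_ge.
  apply: (le_trans (logNSWU_sub_le _ _)).
  apply: (@le_trans _ _ (\sum_(w <- (Opt `\` A)%fset) g)).
    rewrite big_seq [leRHS]big_seq; apply: ler_sum => w.
    rewrite inE => /andP[wA wO]; apply: vmax => /=.
    by rewrite inE wA (fsubsetP OP).
  (* The constant sum is [g] times the size of Opt minus A; since [g] is nonnegative, that size may
     be replaced by k. *)
  rewrite big_const_seq count_predT iter_addr_0 -(mulr_natl g) ler_wpM2r// ler_nat.
  by rewrite -cO fsubset_leq_card// fsubsetDl.
have -> : f Opt - f (A `|` [fset v])%fset = f Opt - f A - g by rewrite /g; ring.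
apply: (@le_trans _ _ ((1 - k%:R^-1) * (f Opt - f A))).
  have : k%:R^-1 * (f Opt - f A) <= g by rewrite ler_pdivrMl.
  by rewrite mulrBl mul1r; lra.
by rewrite exprS -mulrA ler_wpM2l// subr_ge0 invf_le1.
Qed.

Lemma greedy_approx k Opt A :
  (0 < k)%N -> (Opt `<=` P)%fset -> #|` Opt|%fset = k ->
  greedy P sigma atb 1 q k A ->
  (1 - 1 / expR 1) * f Opt <= f A.
Proof.
move=> k0 OP cO gA; have := greedy_gap k Opt k A k0 OP cO gA.
have := ler_wpM2r (logNSW_ge0 Opt) (@expr_1sub_inv_le R k k0).
by rewrite div1r mulrBl mul1r; lra.
Qed.

End Objective.

Arguments attr_weight {R d c}.

(** * A program logic with step counts *)

Section Machine.
Variables (R : realType) (d c : nat).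
Variables (sigma : 'rV[R]_d -> 'rV[R]_d -> R) (atb : 'rV[R]_d -> {set 'I_c}).
Variables (ps : seq 'rV[R]_d) (q : 'rV[R]_d) (tau : nat).

(** Loops are bounded, so [run] is total: correctness and running time are stated together of its
    result, with no termination obligation. *)
Definition wp (p : cmd) (m : memory R) (Q : memory R -> Prop) (B : nat) : Prop :=
  Q (run sigma atb ps q tau p m).1 /\ ((run sigma atb ps q tau p m).2 <= B)%N.

Lemma wp_weaken {p m B B'} {Q Q' : memory R -> Prop} :
  wp p m Q B -> (forall m', Q m' -> Q' m') -> (B <= B')%N -> wp p m Q' B'.
Proof. by move=> [Qm mB] QQ' BB'; split; [exact: QQ'|exact: leq_trans BB']. Qed.

Lemma wp_seq {p1 p2 m Q B1 B2} :
  wp p1 m (fun m1 => wp p2 m1 Q B2) B1 -> wp (Seq p1 p2) m Q (B1 + B2).+1.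
Proof. by move=> [[Q2 B2m] B1m]; split => //=; rewrite ltnS leq_add. Qed.

(** The invariant is indexed by the number of completed iterations and holds before the counter is
    written. Induction on the bound peels off the last iteration. *)
Lemma wp_for (I : nat -> memory R -> Prop) B {x e p m} :
  I 0%N m ->
  (forall j m', (j < neval m e)%N -> I j m' ->
     wp p (Memory (upd (nmem m') x 0 j) (rmem m')) (I j.+1) B) ->
  wp (For x e p) m (I (neval m e)) ((ncost e).+1 + neval m e * B.+1).
Proof.
rewrite /wp /=; elim: (neval m e) => [|n IHn] I0 Istep.
  by rewrite mul0n addn0.
have [|In Bn] := IHn I0; first by move=> j m' jn; apply: Istep; exact: ltnW.
rewrite -addn1 iotaD foldl_cat /= add0n addn1.
have [In1 Bn1] := Istep n _ (ltnSn n) In; split=> //.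
by move: Bn Bn1; set r := foldl _ _ _; lia.
Qed.

Lemma wp_if {b p1 p2 m Q B} :
  (beval sigma atb ps q m b -> wp p1 m Q B) ->
  (~~ beval sigma atb ps q m b -> wp p2 m Q B) ->
  wp (If b p1 p2) m Q (bcost tau b + B).+1.
Proof.
rewrite /wp /=; case: ifP => [_ H _|_ _ H].
  by have [HQ HB] := H isT; split=> //; rewrite ltnS leq_add2l.
by have [HQ HB] := H isT; split=> //; rewrite ltnS leq_add2l.
Qed.

(** A frame condition at the granularity of whole arrays: [ns] and [rs] list the natural and real
    arrays that may change. *)
Definition agree_off (ns rs : seq nat) (m m' : memory R) : Prop :=
  (forall a i, a \notin ns -> nmem m' a i = nmem m a i) /\
  (forall a i, a \notin rs -> rmem m' a i = rmem m a i).

Lemma agree_off_trans {ns rs ns' rs' m1 m2 m3} :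
  agree_off ns rs m1 m2 -> agree_off ns' rs' m2 m3 ->
  all (mem ns) ns' -> all (mem rs) rs' -> agree_off ns rs m1 m3.
Proof.
move=> [N12 R12] [N23 R23] /allP sn /allP sr; split=> a i aN.
  by rewrite N23 ?N12//; apply: contraNN aN => /sn.
by rewrite R23 ?R12//; apply: contraNN aN => /sr.
Qed.

Lemma agree_off_nset ns rs m N S a i x : a \in ns ->
  agree_off ns rs m (Memory N S) -> agree_off ns rs m (Memory (upd N a i x) S).
Proof.
move=> ans [mN mS]; split=> [b j bN|//]; rewrite /= /upd ifF; first exact: mN.
by apply: contraNF bN => /andP[/eqP-> _].
Qed.

Lemma agree_off_rset ns rs m N S a i x : a \in rs ->
  agree_off ns rs m (Memory N S) -> agree_off ns rs m (Memory N (upd S a i x)).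
Proof.
move=> ars [mN mS]; split=> [//|b j bN]; rewrite /= /upd ifF; first exact: mS.
by apply: contraNF bN => /andP[/eqP-> _].
Qed.

(** * Specifications of the subprograms *)

(** The machine's version of [attr_weight]: attributes are plain naturals, tested as [BAtb] does. *)
Definition index_weight (i l : nat) : R :=
  if l \in [seq val j | j in atb (nth 0 ps i)] then sigma q (nth 0 ps i) else 0.

Definition gain (U : nat -> R) (i : nat) : R :=
  (\sum_(0 <= l < c) (ln (U l + index_weight i l + 1) - ln (U l + 1))) / c%:R.

(* The numerical constants of this and the next cost bounds are rounded up. *)
Lemma compute_gain_wp m : nmem m vC 0 = c ->
  wp compute_gain m
    (fun m' => agree_off [:: vL] [:: wNew; wGain] m m' /\
       rmem m' wGain 0 = gain (rmem m wU) (nmem m vI 0))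
    (c.+1 * (60 + tau)).
Proof.
move=> mC.
pose I j m' := agree_off [:: vL] [:: wNew; wGain] m m' /\
  rmem m' wGain 0 = \sum_(0 <= l < j)
    (ln (rmem m wU l + index_weight (nmem m vI 0) l + 1) - ln (rmem m wU l + 1)).
apply: (@wp_weaken _ _ (4 + ((3 + c * (45 + tau).+1) + 10).+1).+1); last 2 first.
- by move=> m' H; exact: H.
- by lia.
apply: wp_seq; split=> //=.
apply: wp_seq.
set m0 := Memory _ _.
apply: (@wp_weaken _ _ (3 + c * (45 + tau).+1) _ (I c)); last 2 first.
- move=> [N S] [mm' /= gE]; split=> //; split=> /=; first exact: agree_off_rset.
  have NC : N vC 0 = c by rewrite -mC; exact: mm'.1.
  by rewrite /upd /= gE NC.
- by lia.
have -> : c = neval m0 (NGet vC (NLit 0)) by rewrite /= mC.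
apply: (@wp_for I).
  split; last by rewrite /= /upd /= big_geq.
  by apply: agree_off_rset => //; case: (m).
move=> j [N S] jc [mm' /= gE]; rewrite /wp /=.
have NI : N vI 0 = nmem m vI 0 by exact: mm'.1.
have SU l : S wU l = rmem m wU l by exact: mm'.2.
have upL (x : nat) : upd N vL 0 x vL 0 = x by [].
have upI (x : nat) : upd N vL 0 x vI 0 = N vI 0 by [].
rewrite upL upI NI SU.
rewrite /I big_nat_recr//= -gE.
rewrite /index_weight.
case: ifP => jatb; cbn [run neval reval beval fst snd nmem rmem].
  split; last by lia.
  split; last by rewrite /upd /= SU.
  by do ?apply: agree_off_rset => //; exact: agree_off_nset.
split; last by lia.
split; last by rewrite /upd /= SU addr0.
by do ?apply: agree_off_rset => //; exact: agree_off_nset.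
Qed.

Definition is_best (sel : nat -> nat) (U : nat -> R) (n b : nat) : Prop :=
  [/\ (b < n)%N, sel b = 0%N &
      forall i, (i < n)%N -> sel i = 0%N -> gain U i <= gain U b].

(** The free index guarantees that the scan ends with a candidate; otherwise [vBest] would keep a
    stale value. *)
Lemma find_best_wp m : nmem m vN 0 = size ps -> nmem m vC 0 = c ->
  (exists2 i, (i < size ps)%N & nmem m vSel i = 0%N) ->
  wp find_best m
    (fun m' =>
       agree_off [:: vFound; vBest; vI; vL] [:: wNew; wGain; wBest] m m' /\
       is_best (nmem m vSel) (rmem m wU) (size ps) (nmem m' vBest 0))
    ((size ps).+1 * (c.+1 * (60 + tau) + 50)).
Proof.
move=> mN mC [i0 i0n i0sel].
(* Until a free index has been met, [wBest] and [vBest] are arbitrary, so the invariant branches on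
   the flag [vFound]. *)
pose I j m' :=
  agree_off [:: vFound; vBest; vI; vL] [:: wNew; wGain; wBest] m m' /\
  ((nmem m' vFound 0 = 0%N /\ forall i, (i < j)%N -> nmem m vSel i <> 0%N) \/
   [/\ nmem m' vFound 0 = 1%N,
       rmem m' wBest 0 = gain (rmem m wU) (nmem m' vBest 0) &
       is_best (nmem m vSel) (rmem m wU) j (nmem m' vBest 0)]).
pose B := (c.+1 * (60 + tau) + 40)%N.
apply: (@wp_weaken _ _ (3 + (3 + size ps * B.+1)).+1); last 2 first.
- by move=> m' H; exact: H.
- by rewrite /B; lia.
apply: wp_seq; split=> //=.
set m0 := Memory _ _.
apply: (@wp_weaken _ _ (3 + size ps * B.+1) _ (I (size ps))) => //; last first.
  by move=> m' [mm' [[_ /(_ _ i0n)]|[]]].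
have -> : size ps = neval m0 (NGet vN (NLit 0)) by rewrite -mN.
apply: (@wp_for I).
  split; last by left.
  by apply: agree_off_nset => //; case: (m).
move=> j m' jn [mm' best].
set m1 := Memory _ _.
have mm1 : agree_off [:: vFound; vBest; vI; vL] [:: wNew; wGain; wBest] m m1.
  by apply: agree_off_nset => //; case: (m') mm'.
(* The test costs 5 and the conditional 1, which leaves B - 6 for the branches. *)
apply: (@wp_weaken _ _ (5 + (B - 6)).+1); last 2 first.
- by move=> m2 H; exact: H.
- by rewrite /B; lia.
have m1sel : nmem m1 vSel (nmem m1 vI 0) = nmem m vSel j by exact: mm1.1.
apply: wp_if => [/eqP selj|/eqP selj]; rewrite /neval m1sel in selj.
  apply: (@wp_weaken _ _ (c.+1 * (60 + tau) + 26).+1); last 2 first.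
  - by move=> m2 H; exact: H.
  - by rewrite /B; lia.
  apply: wp_seq.
  have mC1 : nmem m1 vC 0 = c by rewrite -mC; exact: mm1.1.
  apply: (wp_weaken (compute_gain_wp m1 mC1)) => // m2 [m12 g2].
  have mm2 := agree_off_trans mm1 m12 isT isT.
  have Ij : nmem m1 vI 0 = j by [].
  have U1 : rmem m1 wU = rmem m wU by apply/funext => l; exact: mm1.2.
  rewrite U1 Ij in g2.
  have found2 : nmem m2 vFound 0 = nmem m' vFound 0 by exact: m12.1.
  have best2 : nmem m2 vBest 0 = nmem m' vBest 0 by exact: m12.1.
  have wbest2 : rmem m2 wBest 0 = rmem m' wBest 0 by exact: m12.2.
  have I2 : nmem m2 vI 0 = j by exact: m12.1.
  rewrite -found2 -best2 -wbest2 in best.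
  case: m2 {m12 found2 best2 wbest2} mm2 g2 I2 best => [N S] mm2 /= g2 I2 best.
  have lt1 i : (i < j.+1)%N -> i = j \/ (i < j)%N by lia.
  apply: (@wp_weaken _ _ (12 + 13).+1); last 2 first.
  - by move=> m2 H; exact: H.
  - by [].
  (* If the test succeeds, [j] becomes the candidate and dominates any old one by transitivity; if
     it fails, a candidate exists and its gain is at least that of [j]. *)
  apply: wp_if => /= cond; split=> //=; split.
  - by do ?[apply: agree_off_rset => //|apply: agree_off_nset => //].
  - right; split=> //=; first by rewrite /upd /= g2 I2.
    rewrite /upd /= I2; split=> // i /lt1[->//|ij] seli.
    case: best => [[_ /(_ _ ij)]//|[f1 wB [_ _ bmax]]].
    apply: (le_trans (bmax _ ij seli)).
    by move: cond; rewrite f1 wB g2 /= => /ltW.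
  - exact: mm2.
  - right; case: best => [[f0]|[f1 wB [bj selb bmax]]]; first by rewrite f0 in cond.
    split=> //; split=> // [|i /lt1[->|ij] seli]; first exact: ltnW.
      by move: cond; rewrite f1 wB g2 /= -leNgt.
    exact: bmax.
split; last by rewrite /B /=; lia.
split=> //; case: best => [[f0 nosel]|[f1 wB [bj selb bmax]]].
  left; split=> // i; rewrite ltnS leq_eqVlt => /orP[/eqP->//|]; exact: nosel.
right; split=> //; split=> // [|i]; first exact: ltnW.
by rewrite ltnS leq_eqVlt => /orP[/eqP->//|]; exact: bmax.
Qed.

Lemma add_best_wp m : nmem m vC 0 = c ->
  wp add_best m
    (fun m' => [/\ agree_off [:: vSel; vL] [:: wU] m m',
        forall i, nmem m' vSel i = if i == nmem m vBest 0 then 1%N else nmem m vSel i &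
        forall l, (l < c)%N ->
          rmem m' wU l = rmem m wU l + index_weight (nmem m vBest 0) l])
    (c.+1 * (40 + tau)).
Proof.
move=> mC.
(* The invariant covers every cell of [wU]: those not yet visited must still hold their old value
   when the loop reads them. *)
pose I j m' := [/\ agree_off [:: vSel; vL] [:: wU] m m',
  forall i, nmem m' vSel i = if i == nmem m vBest 0 then 1%N else nmem m vSel i &
  forall l, rmem m' wU l =
    rmem m wU l + if (l < j)%N then index_weight (nmem m vBest 0) l else 0].
apply: (@wp_weaken _ _ (4 + (3 + c * (30 + tau).+1)).+1); last 2 first.
- by move=> m' H; exact: H.
- by lia.
apply: wp_seq; split=> //=.
set m0 := Memory _ _.
apply: (@wp_weaken _ _ (3 + c * (30 + tau).+1) _ (I c)) => //; last first.
  by move=> m' [mm' selE UE]; split=> // l lc; rewrite UE lc.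
have -> : c = neval m0 (NGet vC (NLit 0)) by rewrite -mC.
apply: (@wp_for I).
  split=> [|//|l]; last by rewrite addr0.
  by apply: agree_off_nset => //; case: (m).
move=> j [N S] jc [mm' /= selE UE]; rewrite /wp /=.
have NB : N vBest 0 = nmem m vBest 0 by exact: mm'.1.
have -> (x : nat) : upd N vL 0 x vBest 0 = nmem m vBest 0 by [].
have -> (x : nat) : upd N vL 0 x vL 0 = x by [].
have SUj l : upd S wU j (S wU j + sigma q (nth 0 ps (nmem m vBest 0))) wU l =
    if l == j then S wU j + sigma q (nth 0 ps (nmem m vBest 0)) else S wU l by [].
case: ifP => jatb /=; split; try by lia.
- split=> //=; first by apply: agree_off_rset => //; exact: agree_off_nset.
  move=> l; rewrite SUj ltnS leq_eqVlt; case: eqVneq => [->|_]; last exact: UE.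
  by rewrite /= UE ltnn addr0 /index_weight jatb.
- split=> //=; first by apply: agree_off_nset.
  move=> l; rewrite ltnS leq_eqVlt UE; case: eqVneq => [->|//].
  by rewrite ltnn /= /index_weight jatb.
Qed.

(** * From index arrays to sets of vectors *)

(** The comprehension of [multiNashANN_output], with the selection array as a parameter so that it
    applies in every round. *)
Definition chosen (sel : nat -> nat) : {fset 'rV[R]_d} :=
  [fset v in ([seq nth 0 ps i | i <- iota 0 (size ps) & sel i == 1%N]
                : seq 'rV[R]_d)]%fset.

Lemma chosenP sel v :
  reflect (exists i, [/\ (i < size ps)%N, sel i = 1%N & v = nth 0 ps i])
          (v \in chosen sel).
Proof.
rewrite !inE/=; apply: (iffP mapP) => [[i]|[i [ips si ->]]].
  by rewrite mem_filter mem_iota => /andP[/eqP si /= ips] ->; exists i.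
by exists i; rewrite // mem_filter mem_iota si.
Qed.

(** Without repetitions in [ps], a vector determines its index, so a single cell decides
    membership. *)
Lemma mem_chosen sel i : uniq ps -> (i < size ps)%N ->
  (nth 0 ps i \in chosen sel) = (sel i == 1%N).
Proof.
move=> ups ips; apply/chosenP/eqP => [[j [jps sj /eqP]]|si]; last by exists i.
by rewrite nth_uniq// => /eqP->.
Qed.

Lemma chosen_add sel sel' b : (b < size ps)%N ->
  (forall i, sel' i = if i == b then 1%N else sel i) ->
  chosen sel' = (chosen sel `|` [fset nth 0 ps b])%fset.
Proof.
move=> bps sel'E; apply/fsetP => v; rewrite in_fsetU in_fset1.
apply/chosenP/orP => [[i [ips]]|[/chosenP[i [ips si ->]]|/eqP->]].
- rewrite sel'E; case: eqP => [-> _ ->|_ si ->]; first by right.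
  by left; apply/chosenP; exists i.
- by exists i; rewrite sel'E si if_same.
- by exists b; rewrite sel'E eqxx.
Qed.

Variables (P : {fset 'rV[R]_d}).
Hypothesis psP : perm_eq ps P.

Local Notation u := (utility P sigma atb q).
Local Notation f := (logNSW P sigma atb 1 q).

Let ps_uniq : uniq ps.
Proof. by rewrite (perm_uniq psP) fset_uniq. Qed.

Lemma index_weightE i (l : 'I_c) : (i < size ps)%N ->
  index_weight i l = attr_weight P sigma atb q l (nth 0 ps i).
Proof.
move=> ips; rewrite /index_weight fintype.mem_image; last exact: val_inj.
by rewrite /attr_weight !inE/= -(perm_mem psP) mem_nth.
Qed.

Lemma gainE (U : nat -> R) (A : {fset 'rV[R]_d}) i :
  (i < size ps)%N -> nth 0 ps i \notin A ->
  (forall l : 'I_c, U l = u l A) ->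
  gain U i = f (A `|` [fset nth 0 ps i])%fset - f A.
Proof.
move=> ips iA UE; rewrite /gain mulrC big_mkord /logNSW -mulrBr -sumrB.
congr (_ * _); apply: eq_bigr => l _.
by rewrite UE index_weightE// utilityU1.
Qed.

(** Every vector of P outside the chosen set sits at an index whose cell is 0, so maximality over
    free indices is maximality over vectors. *)
Lemma argmax_chosen sel (U : nat -> R) b :
  (forall i, sel i = 0%N \/ sel i = 1%N) ->
  (forall l : 'I_c, U l = u l (chosen sel)) ->
  is_best sel U (size ps) b ->
  argmax [set w | w \in (P `\` chosen sel)%fset]
    (fun w => f (chosen sel `|` [fset w])%fset - f (chosen sel)) (nth 0 ps b).
Proof.
move=> sel01 UE [bps selb bmax].
have bN : nth 0 ps b \notin chosen sel by rewrite mem_chosen// selb.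
split=> [|w]; rewrite /= in_fsetD.
  by rewrite bN -(perm_mem psP) mem_nth.
rewrite -(perm_mem psP) => /andP[wN /nthP-/(_ 0)[i ips wE]].
rewrite -wE in wN *; rewrite -!(gainE _ _ _ _ _ UE)//; apply: bmax => //.
by case: (sel01 i) => // si; move: wN; rewrite mem_chosen// si eqxx.
Qed.

Lemma multiNashANN_wp k : (k <= #|` P|)%N ->
  wp multiNashANN (init_memory R (size ps) c k)
    (fun m => greedy P sigma atb 1 q k (chosen (nmem m vSel)))
    (3 + k * ((size ps).+1 * (c.+1 * (60 + tau) + 50) + c.+1 * (40 + tau)).+2).
Proof.
move=> kP; set B := addn (_ * _) (c.+1 * _).
(* The program tests cells of [vSel] against 0 whereas [chosen] tests them against 1; keeping them
   in {0, 1} makes the two tests complementary. *)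
pose I j (m : memory R) := [/\ nmem m vN 0 = size ps, nmem m vC 0 = c,
  forall i, nmem m vSel i = 0%N \/ nmem m vSel i = 1%N,
  forall l : 'I_c, rmem m wU l = u l (chosen (nmem m vSel)) &
  greedy P sigma atb 1 q j (chosen (nmem m vSel))].
set m0 := init_memory _ _ _ _.
apply: (@wp_weaken _ _ (3 + k * B.+2) _ (I k)) => //; last by move=> m [].
have -> : k = neval m0 (NGet vK (NLit 0)) by [].
apply: (@wp_for I).
  have chosen0 : chosen (nmem m0 vSel) = fset0.
    by apply/fsetP => v; rewrite inE; apply/chosenP => -[i []].
  split=> //; try by left.
    by move=> l; rewrite chosen0 utilityE big_nil.
  by rewrite chosen0; exact: greedy_start.
move=> j m jk [mN mC sel01 UE gA]; apply: wp_seq.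
set m1 := Memory _ _.
(* After j < k <= |P| rounds the chosen set has j elements, so it cannot contain P. *)
have free : exists2 i, (i < size ps)%N & nmem m vSel i = 0%N.
  have [AP cA] := greedy_sub_card _ _ _ _ _ _ _ _ _ gA.
  have : ~~ (P `<=` chosen (nmem m vSel))%fset.
    by apply: contraTN (jk : (j < k)%N) => /fsubset_leq_card; rewrite cA -leqNgt; lia.
  case/fsubsetPn => v; rewrite -(perm_mem psP) => /nthP-/(_ 0)[i ips <-].
  rewrite mem_chosen// => si; exists i => //.
  by case: (sel01 i) => // si1; rewrite si1 in si.
apply: (wp_weaken (find_best_wp m1 mN mC free)) => // m2 [m12 best].
have sel2 : nmem m2 vSel = nmem m vSel by apply/funext => i; exact: m12.1.
have U2 : rmem m2 wU = rmem m wU by apply/funext => i; exact: m12.2.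
have mC2 : nmem m2 vC 0 = c by rewrite -mC; exact: m12.1.
have bps : (nmem m2 vBest 0 < size ps)%N by case: best.
apply: (wp_weaken (add_best_wp m2 mC2)) => // m3 [m23 sel3 U3].
rewrite sel2 in sel3.
have ch3 := chosen_add _ _ _ bps sel3.
split.
- by rewrite -mN m23.1// m12.1.
- by rewrite -mC2; exact: m23.1.
- by move=> i; rewrite sel3; case: ifP => // _; right.
- move=> l; rewrite ch3 U3// U2 UE utilityU1 ?index_weightE//.
  by case: best => _ selb _; rewrite mem_chosen// [nmem m vSel _]selb.
- by rewrite ch3; apply: greedy_round gA _; exact: argmax_chosen best.
Qed.

End Machine.

(** * The polynomial time bound and the conclusion *)

Lemma multiNashANN_cost_le (n k c tau M : nat) :
  (k <= M)%N -> (n < M)%N -> (c < M)%N -> (tau < M)%N ->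
  (3 + k * (n.+1 * (c.+1 * (60 + tau) + 50) + c.+1 * (40 + tau)).+2
     <= 155 * M ^ 4)%N.
Proof.
move=> kM nM cM tM.
have M2 : (M <= M ^ 2)%N by rewrite -[leqLHS]expn1 leq_pexp2l//; lia.
have M3 : (M ^ 2 <= M ^ 3)%N by rewrite leq_pexp2l//; lia.
have M4 : (M ^ 3 <= M ^ 4)%N by rewrite leq_pexp2l//; lia.
(* Lower powers of M are absorbed into higher ones, so constants add up: 110 = 60 + 50, then 152 =
   110 + 40 + 2, and finally 155 = 152 + 3. *)
have b60 : (c.+1 * (60 + tau) <= M * (60 * M))%N by rewrite leq_mul//; lia.
have b40 : (c.+1 * (40 + tau) <= M * (40 * M))%N by rewrite leq_mul//; lia.
have bn : (n.+1 * (c.+1 * (60 + tau) + 50) <= M * (110 * M ^ 2))%N.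
  by rewrite leq_mul//; lia.
have bk : (k * (n.+1 * (c.+1 * (60 + tau) + 50) + c.+1 * (40 + tau)).+2
    <= M * (152 * M ^ 3))%N by rewrite leq_mul//; lia.
lia.
Qed.

Theorem theorem3 (R : realType) :
  exists T : {poly nat},
  forall (d c k : nat) (P : {fset 'rV[R]_d})
         (sigma : 'rV[R]_d -> 'rV[R]_d -> R) (atb : 'rV[R]_d -> {set 'I_c}),
    (forall x y : 'rV[R]_d, 0 <= sigma x y) ->
    (0 < k)%N ->
    (k <= #|` P|%fset)%N ->
    (forall v : 'rV[R]_d, v \in P -> atb v != finset.set0) ->
  forall q : 'rV[R]_d,
    (forall (ps : seq 'rV[R]_d) (tau : nat), perm_eq ps P ->
       greedy P sigma atb 1 q k (multiNashANN_output sigma atb ps k q tau) /\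
       (multiNashANN_time sigma atb ps k q tau
          <= T.[(#|` P|%fset + d + c + tau)%N])%N) /\
    (forall Alg : {fset 'rV[R]_d}, greedy P sigma atb 1 q k Alg ->
       [/\ (Alg `<=` P)%fset,
           #|` Alg|%fset = k &
           forall Opt : {fset 'rV[R]_d}, optimal P sigma atb 1 k q Opt ->
             (1 - 1 / expR 1) * logNSW P sigma atb 1 q Opt
               <= logNSW P sigma atb 1 q Alg]).
Proof.
(* The shift by 1 makes M = |P| + d + c + tau + 1 strictly larger than |P|, c and tau, as the cost
   lemma requires. *)
exists (155%:P * ('X + 1%:P) ^+ 4) => d c k P sigma atb sigma_ge0 k0 kP _ q.
split=> [ps tau psP|A gA].
  have [gr time] := multiNashANN_wp R d c sigma atb ps q tau P psP k kP.
  split; first exact: gr.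
  apply: (leq_trans time).
  rewrite hornerM hornerC horner_exp hornerD hornerX hornerC natn natrDE.
  rewrite natrXE natrME addn1.
  have sP : size ps = #|` P|%fset by exact: perm_size.
  by apply: multiNashANN_cost_le; rewrite ?sP; lia.
have [AP cA] := greedy_sub_card _ _ _ _ _ _ _ _ _ gA; split=> // Opt [[OP cO] _].
exact: greedy_approx gA.
Qed.
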